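(* Let $(V_1,\|\cdot\|_1)$ and $(V_2,\|\cdot\|_2)$ be real normed spaces and let $G\in\Delta^+$ with $G\ne\epsilon_0$, $G\ne\epsilon_{+\infty}$. The $\tau_M$-product of the two simple PN spaces $(V_1,\|\cdot\|_1,G,M)$ and $(V_2,\|\cdot\|_2,G,M)$ is the simple space under $M$ generated by $(V_1\times V_2,\|\cdot\|_s)$ and the same $G$, namely $(V_1\times V_2,\|\cdot\|_s,G,M)$, where $\|(p_1,p_2)\|_s:=\|p_1\|_1+\|p_2\|_2$.
   Context: $\Delta^+$ is the set of distance distribution functions: nondecreasing $F:[0,+\infty]\to[0,1]$ with $F(0)=0$, $F(+\infty)=1$, left-continuous on $(0,+\infty)$; it is ordered pointwise and endowed with the topology of weak convergence. $\epsilon_0(x)=0$ for $x\le0$ and $1$ for $x>0$; $\epsilon_{+\infty}(x)=0$ for $x<+\infty$ and $\epsilon_{+\infty}(+\infty)=1$. A triangle function is a binary operation on $\Delta^+$ that is commutative, associative, nondecreasing in each argument and has $\epsilon_0$ as identity. Let $M(x,y)=\min\{x,y\}$ and $M^*(x,y)=\max\{x,y\}$ on $[0,1]$, $\tau_M(F,H)(x)=\sup_{s+t=x}M(F(s),H(t))$ and $\tau_{M^*}(F,H)(x)=\inf_{s+t=x}M^*(F(s),H(t))$. A PN space is a quadruple $(V,\nu,\tau,\tau^* )$ where $V$ is a real linear space with null vector $\theta$, $\tau,\tau^*$ are continuous (for weak convergence) triangle functions with $\tau\le\tau^*$, and $\nu:V\to\Delta^+$, $p\mapsto\nu_p$, satisfies: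 (N1) $\nu_p=\epsilon_0$ iff $p=\theta$; (N2) $\nu_{-p}=\nu_p$; (N3) $\nu_{p+q}\ge\tau(\nu_p,\nu_q)$; (N4) $\nu_p\le\tau^*(\nu_{\alpha p},\nu_{(1-\alpha)p})$ for all $\alpha\in[0,1]$; for all $p,q\in V$. The simple PN space $(V,\|\cdot\|,G,M)$ generated by a normed space $(V,\|\cdot\|)$ and $G$ is $(V,\nu,\tau_M,\tau_{M^*})$ with $\nu_\theta=\epsilon_0$ and $\nu_p(t)=G(t/\|p\|)$ for $p\neq\theta$. The $\tau_M$-product of two PN spaces $(V_1,\nu_1,\tau,\tau^* )$, $(V_2,\nu_2,\tau,\tau^* )$ is $(V_1\times V_2,\nu^{\tau_M},\tau,\tau^* )$ with $\nu^{\tau_M}(p_1,p_2):=\tau_M(\nu_1(p_1),\nu_2(p_2))$. *)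

(* Defs.v *)
From HB Require Import structures.
From mathcomp Require Import all_boot all_order all_algebra.
From mathcomp Require Import all_classical all_reals all_analysis.

Set Implicit Arguments.
Unset Strict Implicit.
Unset Printing Implicit Defensive.

Import Order.TTheory GRing.Theory Num.Theory.
Import numFieldNormedType.Exports.

Local Open Scope classical_set_scope.
Local Open Scope ring_scope.

(* A distance distribution function is defined on [0, +oo]; it is represented
   by its unique extension to \bar R that vanishes on [-oo, 0]. *)
Record is_ddf (R : realType) (F : \bar R -> R) : Prop := IsDdf {
  ddf_homo : forall x y : \bar R, (x <= y)%E -> F x <= F y;
  ddf_itv : forall x : \bar R, 0 <= F x <= 1;
  ddf_le0 : forall x : \bar R, (x <= 0)%E -> F x = 0;
  ddf_pinfty : F +oo%E = 1;
  ddf_left_cvg : forall x : R, 0 < x ->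
    (fun y : R => F y%:E) @ x^'- --> F x%:E
}.

Record ddf (R : realType) := Ddf {
  ddf_fun :> \bar R -> R;
  ddfP : is_ddf ddf_fun
}.

Lemma ddf_ext (R : realType) (F H : ddf R) : (forall x, F x = H x) -> F = H.
Proof.
case: F H => [F PF] [H PH] /= /funext FH; subst H; congr Ddf.
exact: Prop_irrelevance.
Qed.

Definition ddf_le (R : realType) (F H : ddf R) : Prop :=
  forall x : \bar R, F x <= H x.

Definition ddf_weak_cvg (R : realType) (F_ : nat -> ddf R) (F : ddf R) : Prop :=
  forall x : R, 0 < x -> {for x, continuous (fun y : R => F y%:E)} ->
    (fun n => F_ n x%:E) @ \oo --> F x%:E.

Section left_limits.
Context {R : realType}.
Implicit Types (f : R -> R) (x : R).

Lemma left_cvg_intro f x : {homo f : y z / y <= z} ->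
  (forall c, c < f x -> exists2 y, y < x & c < f y) ->
  f @ x^'- --> f x.
Proof.
move=> fnd fx; apply/cvgrPdist_lt => e e0.
have [|y yx fy] := fx (f x - e); first by rewrite ltrBlDr ltrDl.
near=> z.
have zx : z < x by near: z; exact: nbhs_left_lt.
have yz : y < z by near: z; exact: nbhs_left_gt.
rewrite ger0_norm ?subr_ge0; last exact/fnd/ltW.
rewrite ltrBlDr addrC -ltrBlDr (lt_le_trans fy)//; exact/fnd/ltW.
Unshelve. all: by end_near. Qed.

Lemma left_cvg_elim f x b c : b < x -> f @ x^'- --> f x -> c < f x ->
  exists y, [/\ b < y, y < x & c < f y].
Proof.
move=> bx fx cf.
have fy : \forall y \near x^'-, c < f y by exact: cvgr_gt fx _ cf.
near (x^'-) => y; exists y; split; near: y => //.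
- exact: nbhs_left_gt.
- exact: nbhs_left_lt.
Unshelve. all: by end_near. Qed.

End left_limits.

Definition eps0_fun (R : realType) (x : \bar R) : R := ((0 < x)%E : bool)%:R.

Definition epsoo_fun (R : realType) (x : \bar R) : R := (x == +oo%E)%:R.

Lemma eps0_is_ddf (R : realType) : is_ddf (@eps0_fun R).
Proof.
split; rewrite /eps0_fun.
- move=> x y xy; rewrite ler_nat; case: (ltP 0%E x) => // x0.
  by rewrite (lt_le_trans x0 xy).
- by move=> x; case: (ltP 0%E x); rewrite ?lexx ler01.
- by move=> x x0; rewrite ltNge x0.
- by rewrite lt0y.
- move=> x x0; apply: left_cvg_intro.
    move=> y z yz; rewrite ler_nat !lte_fin; case: (ltP 0 y) => // y0.
    by rewrite (lt_le_trans y0 yz).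
  move=> c cx; exists (x / 2); first by rewrite gtr_pMr// invf_lt1// ltr1n.
  by move: cx; rewrite !lte_fin x0 divr_gt0.
Qed.

Lemma epsoo_is_ddf (R : realType) : is_ddf (@epsoo_fun R).
Proof.
split; rewrite /epsoo_fun.
- move=> x y xy; rewrite ler_nat; case: eqP => // x0.
  by move: xy; rewrite x0 leye_eq => ->.
- by move=> x; case: eqP; rewrite ?lexx ler01.
- by move=> [r||]//; rewrite leye_eq.
- by rewrite eqxx.
- by move=> x x0 /=; exact: cvg_cst.
Qed.

Definition eps0 (R : realType) : ddf R := Ddf (eps0_is_ddf R).

Definition epsoo (R : realType) : ddf R := Ddf (epsoo_is_ddf R).

(* For x < 0 there is no splitting, and the sup and inf below are those of the
   empty set, which are 0 by convention. *)
Definition splits (R : realType) (x : \bar R) : set (\bar R * \bar R) :=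
  [set st | [/\ (0 <= st.1)%E, (0 <= st.2)%E & (st.1 + st.2)%E = x]].

Definition tauM_fun (R : realType) (F H : \bar R -> R) (x : \bar R) : R :=
  sup [set Num.min (F st.1) (H st.2) | st in splits x].

Definition tauMstar_fun (R : realType) (F H : \bar R -> R) (x : \bar R) : R :=
  inf [set Num.max (F st.1) (H st.2) | st in splits x].

Section tau.
Context {R : realType}.
Variables F H : ddf R.

Lemma ddf_ge0 (K : ddf R) x : 0 <= K x.
Proof. by have /andP[] := ddf_itv (ddfP K) x. Qed.

Lemma ddf_le1 (K : ddf R) x : K x <= 1.
Proof. by have /andP[] := ddf_itv (ddfP K) x. Qed.

Lemma splits_neg (x : \bar R) : (x < 0)%E -> splits x = set0.
Proof.
move=> x0; apply/seteqP; split=> // -[s t] [/= s0 t0 stx].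
by move: x0; rewrite -stx ltNge adde_ge0.
Qed.

Lemma splits0l (x : \bar R) : (0 <= x)%E -> splits x (0%E, x).
Proof. by move=> x0; split=> //=; rewrite add0e. Qed.

Lemma splits_fin (x : R) s t : splits x%:E (s, t) ->
  exists s' t' : R, [/\ s = s'%:E, t = t'%:E, 0 <= s', 0 <= t' & s' + t' = x].
Proof.
move: s t => [s||] [t||] [] //=; rewrite !lee_fin => s0 t0 [<-].
by exists s, t.
Qed.

Lemma splits_ge0 (x : \bar R) st : splits x st -> (0 <= x)%E.
Proof. by move: st => [s t] [/= s0 t0 <-]; exact: adde_ge0. Qed.

Lemma splits_le (x y : \bar R) st : splits x st -> (x <= y)%E ->
  exists2 uv, splits y uv & (st.1 <= uv.1)%E /\ (st.2 <= uv.2)%E.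
Proof.
move: st => [s t] /= xst; have := xst => -[/= s0 t0 stx].
move: x y stx xst => [x||] [y||]// stx xst xy.
- have [s' [t' [? ? s0' t0' stx']]] := splits_fin xst; subst s t x.
  rewrite lee_fin in xy.
  exists (s'%:E, (y - s')%:E); rewrite /splits /= ?lee_fin.
    split=> //; last by congr EFin; rewrite addrC subrK.
    by rewrite subr_ge0 (le_trans _ xy)// lerDl.
  by split=> //; rewrite lerBrDr addrC.
- exists (s, +oo%E) => /=; last by rewrite leey.
  by split=> //=; case: s s0 {stx xst}.
- by exists (s, t).
all: by have := splits_ge0 xst.
Qed.

Lemma splits_ge (x y : \bar R) st : splits y st -> (0 <= x)%E -> (x <= y)%E ->
  exists2 uv, splits x uv & (uv.1 <= st.1)%E /\ (uv.2 <= st.2)%E.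
Proof.
move: st => [s t] /= yst; have := yst => -[/= s0 t0 sty] x0 xy.
move: x x0 xy => [x||]// x0 xy; last first.
  by exists (s, t) => //; move: xy; rewrite leye_eq => /eqP yE; rewrite -yE.
have [sx|xs] := leP s x%:E; last first.
  exists (x%:E, 0%E) => /=; first by split=> //=; rewrite adde0.
  by split=> //; exact: ltW.
move: s s0 sx sty yst => [s||]// s0 sx sty yst.
rewrite lee_fin in sx; exists (s%:E, (x - s)%:E); rewrite /splits /= ?lee_fin.
  split=> //; first by rewrite subr_ge0.
  by congr EFin; rewrite addrC subrK.
split=> //; move: xy; rewrite -sty; case: t t0 {sty yst} => [t||]//= _.
  by rewrite !lee_fin => ?; rewrite lerBlDr addrC.
by move=> _; exact: leey.
Qed.

Let minFH (st : \bar R * \bar R) := Num.min (F st.1) (H st.2).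
Let maxFH (st : \bar R * \bar R) := Num.max (F st.1) (H st.2).

Let minFH_ge0 st : 0 <= minFH st.
Proof. by rewrite /minFH le_min !ddf_ge0. Qed.

Let minFH_le1 st : minFH st <= 1.
Proof. by rewrite /minFH ge_min !ddf_le1. Qed.

Let maxFH_ge0 st : 0 <= maxFH st.
Proof. by rewrite /maxFH le_max !ddf_ge0. Qed.

Let maxFH_le1 st : maxFH st <= 1.
Proof. by rewrite /maxFH ge_max !ddf_le1. Qed.

Lemma tauM_ge (x : \bar R) st : splits x st ->
  Num.min (F st.1) (H st.2) <= tauM_fun F H x.
Proof.
move=> xst; apply: ub_le_sup; last by exists st.
by exists 1 => _ [uv _ <-]; exact: minFH_le1.
Qed.

Lemma tauM_le (x : \bar R) c : 0 <= c ->
  (forall st, splits x st -> Num.min (F st.1) (H st.2) <= c) ->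
  tauM_fun F H x <= c.
Proof.
move=> c0 xc; rewrite /tauM_fun; have [x0|x0] := ltP x 0%E.
  by rewrite splits_neg// image_set0 sup0.
apply: ge_sup => [|_ [st xst <-]]; last exact: xc.
by exists (minFH (0%E, x)), (0%E, x) => //; exact: splits0l.
Qed.

Lemma tauM_ex (x : \bar R) c : 0 <= c -> c < tauM_fun F H x ->
  exists2 st, splits x st & c < Num.min (F st.1) (H st.2).
Proof.
move=> c0 cx; apply: contrapT => nex; move: cx; apply/negP; rewrite -leNgt.
apply: tauM_le => // st xst; rewrite leNgt; apply/negP => cst.
by apply: nex; exists st.
Qed.

Lemma tauMstar_le (x : \bar R) st : splits x st ->
  tauMstar_fun F H x <= Num.max (F st.1) (H st.2).
Proof.
move=> xst; apply: ge_inf; last by exists st.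
by exists 0 => _ [uv _ <-]; exact: maxFH_ge0.
Qed.

Lemma tauMstar_ge (x : \bar R) c : (0 <= x)%E ->
  (forall st, splits x st -> c <= Num.max (F st.1) (H st.2)) ->
  c <= tauMstar_fun F H x.
Proof.
move=> x0 xc; apply: lb_le_inf => [|_ [st xst <-]]; last exact: xc.
by exists (maxFH (0%E, x)), (0%E, x) => //; exact: splits0l.
Qed.

Lemma tauMstar_ex (x : \bar R) c : (0 <= x)%E -> tauMstar_fun F H x < c ->
  exists2 st, splits x st & Num.max (F st.1) (H st.2) < c.
Proof.
move=> x0 cx; apply: contrapT => nex; move: cx; apply/negP; rewrite -leNgt.
apply: tauMstar_ge => // st xst; rewrite leNgt; apply/negP => cst.
by apply: nex; exists st.
Qed.

Lemma tauM_ge0 x : 0 <= tauM_fun F H x.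
Proof.
have [x0|x0] := ltP x 0%E; last first.
  exact: le_trans (minFH_ge0 _) (tauM_ge (splits0l x0)).
by rewrite /tauM_fun splits_neg// image_set0 sup0.
Qed.

Lemma tauM_homo x y : (x <= y)%E -> tauM_fun F H x <= tauM_fun F H y.
Proof.
move=> xy; apply: tauM_le; first exact: tauM_ge0.
move=> st xst; have [uv yuv [su tv]] := splits_le xst xy.
apply: le_trans (tauM_ge yuv); rewrite le_min !ge_min.
by rewrite (ddf_homo (ddfP F) su) (ddf_homo (ddfP H) tv) orbT.
Qed.

Lemma tauM_is_ddf : is_ddf (tauM_fun F H).
Proof.
split.
- exact: tauM_homo.
- by move=> x; rewrite tauM_ge0 tauM_le// => st _; exact: minFH_le1.
- move=> x x0; apply/eqP; rewrite eq_le tauM_ge0 andbT.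
  apply: tauM_le => // -[s t] [/= s0 t0 stx].
  rewrite ge_min (ddf_le0 (ddfP F)) ?lexx//.
  by apply: le_trans x0; rewrite -stx leeDl.
- apply/eqP; rewrite eq_le tauM_le//=; last by move=> st _; exact: minFH_le1.
  have -> : 1 = Num.min (F +oo%E) (H +oo%E) :> R.
    by rewrite !(ddf_pinfty (ddfP _)) minxx.
  by apply: (@tauM_ge +oo%E (+oo%E, +oo%E)); split=> //=; rewrite leey.
- move=> x x0; apply: left_cvg_intro.
    by move=> y z yz; apply: tauM_homo; rewrite lee_fin.
  move=> c cx; have [c0|c0] := ltP c 0.
    by exists (x - 1); [rewrite ltrBlDr ltrDl|exact: lt_le_trans (tauM_ge0 _)].
  have [[_ _] /splits_fin[s [t [-> -> s0 t0 stx]]] /=] := tauM_ex c0 cx.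
  rewrite lt_min => /andP[cs ct].
  have s_gt0 : 0 < s.
    rewrite lt_neqAle s0 andbT eq_sym; apply: contraTneq cs => ->.
    by rewrite (ddf_le0 (ddfP F))// -leNgt.
  have [y [y0 ys cy]] := left_cvg_elim s_gt0 (ddf_left_cvg (ddfP F) s_gt0) cs.
  exists (y + t); first by rewrite -stx ltrD2r.
  apply: lt_le_trans (@tauM_ge _ (y%:E, t%:E) _); first by rewrite lt_min cy.
  by split=> //=; rewrite lee_fin ltW.
Qed.

Lemma tauMstar_le0 x : (x <= 0)%E -> tauMstar_fun F H x = 0.
Proof.
rewrite le_eqVlt => /predU1P[->|x0]; last first.
  by rewrite /tauMstar_fun splits_neg// image_set0 inf0.
apply/eqP; rewrite eq_le; apply/andP; split.
  apply: le_trans (tauMstar_le (splits0l _)) _ => //=.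
  by rewrite !(ddf_le0 (ddfP _))// maxxx.
by apply: tauMstar_ge => // st _; exact: maxFH_ge0.
Qed.

Lemma tauMstar_ge0 x : 0 <= tauMstar_fun F H x.
Proof.
have [x0|x0] := leP x 0%E; first by rewrite tauMstar_le0.
by apply: tauMstar_ge => [|st _]; [exact: ltW|exact: maxFH_ge0].
Qed.

Lemma tauMstar_homo x y : (x <= y)%E -> tauMstar_fun F H x <= tauMstar_fun F H y.
Proof.
have [x0 _|x0 xy] := leP x 0%E; first by rewrite tauMstar_le0// tauMstar_ge0.
apply: tauMstar_ge => [|st yst]; first exact: ltW (lt_le_trans x0 xy).
have [uv xuv [su tv]] := splits_ge yst (ltW x0) xy.
apply: le_trans (tauMstar_le xuv) _; rewrite ge_max !le_max.
by rewrite (ddf_homo (ddfP F) su) (ddf_homo (ddfP H) tv) orbT.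
Qed.

(* The sublevel sets of a distribution function below a level c are closed
   initial segments of [0, x]. *)
Lemma ddf_sublevel (K : ddf R) (x c : R) : 0 <= x -> 0 <= c ->
  exists s : R, [/\ 0 <= s, s <= x, K s%:E <= c &
    forall y : R, 0 <= y -> y <= x -> K y%:E <= c -> y <= s].
Proof.
move=> x0 c0; pose A := [set y : R | [/\ 0 <= y, y <= x & K y%:E <= c]].
have A0 : A 0 by split=> //; rewrite (ddf_le0 (ddfP K)).
have Aub : ubound A x by move=> y [].
have supA : has_sup A by split; [exists 0|exists x].
have s0 : 0 <= sup A by apply: ub_le_sup A0; exists x.
exists (sup A); split=> //.
- by apply: ge_sup => //; exists 0.
- rewrite leNgt; apply/negP => cs.
  have s_gt0 : 0 < sup A.
    rewrite lt_neqAle s0 andbT eq_sym; apply: contraTneq cs => ->.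
    by rewrite (ddf_le0 (ddfP K))// -leNgt.
  have [y [y0 ys cy]] := left_cvg_elim s_gt0 (ddf_left_cvg (ddfP K) s_gt0) cs.
  have [z [z0 zx zc] yz] : exists2 z, A z & y < z.
    have [|z Az yz] := @sup_adherent _ A (sup A - y) _ supA.
      by rewrite subr_gt0.
    by exists z => //; move: yz; rewrite opprB addrC subrK.
  have := lt_le_trans cy (ddf_homo (ddfP K) (_ : (y%:E <= z%:E)%E)).
  by rewrite lee_fin => /(_ (ltW yz)); rewrite ltNge zc.
- by move=> y y0 yx yc; apply: ub_le_sup; [exists x|split].
Qed.

Lemma tauMstar_is_ddf : is_ddf (tauMstar_fun F H).
Proof.
split.
- exact: tauMstar_homo.
- move=> x; rewrite tauMstar_ge0/=; have [x0|x0] := leP x 0%E.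
    by rewrite tauMstar_le0.
  exact: le_trans (tauMstar_le (splits0l (ltW x0))) (maxFH_le1 _).
- exact: tauMstar_le0.
- apply/eqP; rewrite eq_le; apply/andP; split.
    exact: le_trans (tauMstar_le (splits0l (leey _))) (maxFH_le1 _).
  apply: tauMstar_ge => [|[s t] [/= s0 t0 sty]]; first exact: leey.
  move: s t s0 t0 sty => [s||] [t||]//= _ _ _;
    by rewrite le_max !(ddf_pinfty (ddfP _)) lexx ?orbT.
- move=> x x0; apply: left_cvg_intro.
    by move=> y z yz; apply: tauMstar_homo; rewrite lee_fin.
  move=> c cx; apply: contrapT => nex.
  have yc y : y < x -> tauMstar_fun F H y%:E <= c.
    by move=> yx; rewrite leNgt; apply/negP => cy; apply: nex; exists y.
  have c0 : 0 <= c by apply: le_trans (yc 0 x0); exact: tauMstar_ge0.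
  pose d := (c + tauMstar_fun F H x%:E) / 2.
  have cd : c < d by rewrite /d midf_lt.
  have dx : d < tauMstar_fun F H x%:E by rewrite /d midf_lt.
  have d0 : 0 <= d by rewrite (le_trans c0)// ltW.
  have [s [s0 sx Fs sP]] := ddf_sublevel F (ltW x0) d0.
  have [t [t0 tx Ht tP]] := ddf_sublevel H (ltW x0) d0.
  have xst : x <= s + t.
    rewrite leNgt; apply/negP => stx.
    have [y [sty yx]] : exists y, s + t < y /\ y < x.
      by exists ((s + t + x) / 2); rewrite !midf_lt.
    have y0 : 0 <= y by rewrite (le_trans _ (ltW sty))// addr_ge0.
    have [||[u v] /splits_fin[u' [v' [-> -> u0 v0 uvy]]] /=] :=
      @tauMstar_ex y%:E d; first by rewrite lee_fin.
      exact: le_lt_trans (yc _ yx) cd.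
    rewrite gt_max => /andP[Fu Hv].
    have us : u' <= s.
      apply: sP => //; last exact: ltW.
      by rewrite (le_trans _ (ltW yx))// -uvy lerDl.
    have vt : v' <= t.
      apply: tP => //; last exact: ltW.
      by rewrite (le_trans _ (ltW yx))// -uvy lerDr.
    by move: sty; rewrite -uvy ltNge lerD.
  move: dx; apply/negP; rewrite -leNgt.
  apply: le_trans (@tauMstar_le _ (s%:E, (x - s)%:E) _) _.
    by split=> //=; rewrite ?lee_fin ?subr_ge0//; congr EFin; rewrite addrC subrK.
  rewrite /= ge_max Fs (le_trans _ Ht)// (ddf_homo (ddfP H))// lee_fin.
  by rewrite lerBlDr addrC.
Qed.

End tau.

Definition tauM (R : realType) (F H : ddf R) : ddf R := Ddf (tauM_is_ddf F H).

Definition tauMstar (R : realType) (F H : ddf R) : ddf R :=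
  Ddf (tauMstar_is_ddf F H).

Record triangle_function (R : realType) (tau : ddf R -> ddf R -> ddf R)
    : Prop := TriangleFunction {
  triangle_comm : commutative tau;
  triangle_assoc : associative tau;
  triangle_homo : forall F F' H H' : ddf R,
    ddf_le F F' -> ddf_le H H' -> ddf_le (tau F H) (tau F' H');
  triangle_eps0 : left_id (eps0 R) tau
}.

(* The topology of weak convergence on distance distribution functions is
   metrizable, so continuity is sequential continuity. *)
Definition weakly_continuous (R : realType) (tau : ddf R -> ddf R -> ddf R)
    : Prop :=
  forall (F_ H_ : nat -> ddf R) (F H : ddf R),
    ddf_weak_cvg F_ F -> ddf_weak_cvg H_ H ->
    ddf_weak_cvg (fun n => tau (F_ n) (H_ n)) (tau F H).

Record pn_quadruple (R : realType) := PNQuadruple {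
  pn_carrier : lmodType R;
  pn_nu : pn_carrier -> ddf R;
  pn_tau : ddf R -> ddf R -> ddf R;
  pn_taustar : ddf R -> ddf R -> ddf R
}.

Record is_pn_space (R : realType) (S : pn_quadruple R) : Prop := IsPNSpace {
  pn_tau_triangle : triangle_function (pn_tau S);
  pn_taustar_triangle : triangle_function (pn_taustar S);
  pn_tau_continuous : weakly_continuous (pn_tau S);
  pn_taustar_continuous : weakly_continuous (pn_taustar S);
  pn_tau_le : forall F H : ddf R, ddf_le (pn_tau S F H) (pn_taustar S F H);
  pn_N1 : forall p : pn_carrier S, pn_nu p = eps0 R <-> p = 0;
  pn_N2 : forall p : pn_carrier S, pn_nu (- p) = pn_nu p;
  pn_N3 : forall p q : pn_carrier S,
    ddf_le (pn_tau S (pn_nu p) (pn_nu q)) (pn_nu (p + q));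
  pn_N4 : forall (p : pn_carrier S) (a : R), 0 <= a <= 1 ->
    ddf_le (pn_nu p) (pn_taustar S (pn_nu (a *: p)) (pn_nu ((1 - a) *: p)))
}.

Definition simple_nu_fun (R : realType) (V : normedModType R) (G : ddf R)
    (p : V) (t : \bar R) : R :=
  if p == 0 then eps0 R t else G (t * (`|p|^-1)%:E)%E.

Lemma simple_nu_is_ddf (R : realType) (V : normedModType R) (G : ddf R)
    (p : V) : is_ddf (simple_nu_fun G p).
Proof.
rewrite /simple_nu_fun; have [_|p0] := eqVneq p 0; first exact: eps0_is_ddf.
have n0 : 0 < `|p|^-1 by rewrite invr_gt0 normr_gt0.
have Ghomo x y : (x <= y)%E ->
    G (x * (`|p|^-1)%:E)%E <= G (y * (`|p|^-1)%:E)%E.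
  by move=> xy; apply: (ddf_homo (ddfP G)); rewrite lee_pmul2r// lte_fin.
split=> //.
- by move=> x; exact: ddf_itv (ddfP G) _.
- move=> x x0; apply: (ddf_le0 (ddfP G)).
  by rewrite -(mul0e (`|p|^-1)%:E) lee_pmul2r// lte_fin.
- by rewrite gt0_mulye ?lte_fin// (ddf_pinfty (ddfP G)).
- move=> x x0; apply: left_cvg_intro.
    by move=> y z yz; apply: Ghomo; rewrite lee_fin.
  have xp0 : 0 < x / `|p| by rewrite mulr_gt0.
  move=> c cx.
  have [y [y0 yx cy]] :=
    left_cvg_elim xp0 (ddf_left_cvg (ddfP G) xp0) cx.
  exists (y * `|p|); first by rewrite -ltr_pdivlMr// normr_gt0.
  by rewrite -EFinM mulfK// normr_eq0.
Qed.

Definition simple_nu (R : realType) (V : normedModType R) (G : ddf R) (p : V)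
    : ddf R := Ddf (simple_nu_is_ddf G p).

Definition simple_pn (R : realType) (V : normedModType R) (G : ddf R)
    : pn_quadruple R :=
  PNQuadruple (@simple_nu R V G) (@tauM R) (@tauMstar R).

(* The product is defined for quadruples that share both triangle functions. *)
Definition tauM_product (R : realType) (S1 S2 : pn_quadruple R)
    (_ : pn_tau S1 = pn_tau S2) (_ : pn_taustar S1 = pn_taustar S2)
    : pn_quadruple R :=
  @PNQuadruple R (pn_carrier S1 * pn_carrier S2)%type
    (fun p => tauM (pn_nu p.1) (pn_nu p.2)) (pn_tau S1) (pn_taustar S1).

(* The library norms V1 * V2 with the maximum of the two norms; this alias has
   the same linear structure, normed with the sum. *)
Definition sum_normed (R : realType) (V1 V2 : normedModType R) : Type :=
  (V1 * V2)%type.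

Section sum_normed.
Context {R : realType} {V1 V2 : normedModType R}.
Local Notation V := (sum_normed V1 V2).

HB.instance Definition _ := GRing.Lmodule.copy V (V1 * V2)%type.

Definition sum_norm (p : V) : R := `|p.1| + `|p.2|.

Lemma sum_norm_triangle (p q : V) : sum_norm (p + q) <= sum_norm p + sum_norm q.
Proof. by rewrite /sum_norm addrACA lerD// ler_normD. Qed.

Lemma sum_normZ (a : R) (p : V) : sum_norm (a *: p) = `|a| * sum_norm p.
Proof. by rewrite /sum_norm !normrZ mulrDr. Qed.

Lemma sum_norm_eq0 (p : V) : sum_norm p = 0 -> p = 0.
Proof.
case: p => p1 p2; rewrite /sum_norm => /eqP; rewrite paddr_eq0//= !normr_eq0.
by move=> /andP[/eqP-> /eqP->].
Qed.

HB.instance Definition _ := Lmodule_isNormed.Build R V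
  sum_norm_triangle sum_normZ sum_norm_eq0.

End sum_normed.

(* Main.v *)
(* For nonzero p and q and a vector r with |r| = |p| + |q|, splitting x in the
   ratio |p| : |q| makes both nu_p(u) and nu_q(v) equal to nu_r(x). Any other
   split s + t = x has s <= u or t <= v, and u <= s or v <= t, so this one
   realizes both the supremum of minima and the infimum of maxima:
   tau_M(nu_p, nu_q) = nu_r = tau_M*(nu_p, nu_q). This gives the product formula,
   (N4) with equality, and (N3) since nu_r decreases with |r|.
   Continuity of tau_M and tau_M* uses that weak convergence controls F_n(x) by
   the values of F just to the left and just to the right of x, because the
   continuity points of F are dense. *)
Require Import Defs.
From mathcomp Require Import all_boot all_order all_algebra.
From mathcomp Require Import all_classical all_reals all_analysis.
From mathcomp Require Import lra.

Set Implicit Arguments.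
Unset Strict Implicit.
Unset Printing Implicit Defensive.

Import Order.TTheory GRing.Theory Num.Theory.
Import numFieldNormedType.Exports.

Local Open Scope classical_set_scope.
Local Open Scope ring_scope.

(* Otherwise simplification turns tauM F H into tauM_fun F H. *)
#[local] Arguments ddf_fun : simpl never.

(** * One-sided estimates for weak convergence *)

Section weak_convergence.
Context {R : realType}.
Implicit Types (F H : ddf R).

Lemma ddf_mono F x y : (x <= y)%E -> F x <= F y.
Proof. exact: ddf_homo (ddfP F) _ _. Qed.

Lemma ddf_npos F x : (x <= 0)%E -> F x = 0.
Proof. exact: ddf_le0 (ddfP F) _. Qed.

(** A monotone function has only countably many discontinuities, a null set, while []a, b[] has
    positive measure. *)
Lemma ddf_continuity_point F (a b : R) : 0 <= a -> a < b ->
  exists x : R, [/\ a < x, x < b & {for x, continuous (fun y : R => F y%:E)}].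
Proof.
move=> a0 ab; pose f (y : R) := F y%:E.
have fnd : {homo f : y z / y <= z}.
  by move=> y z yz; apply: ddf_mono; rewrite lee_fin.
have fnd2 : {in `[a, b] &, nondecreasing_fun f} by move=> y z _ _; exact: fnd.
have [x [xab xd]] : exists x, x \in (`]a, b[) /\ ~ discontinuity f x.
  apply: contrapT => nex.
  have /countable_lebesgue_measure0 := discontinuity_countable fnd2.
  rewrite (_ : [set x | _] = [set` `]a, b[]); last first.
    apply/seteqP; split => [x []//|x xab]; split => //.
    by apply: contrapT => xd; apply: nex; exists x.
  rewrite lebesgue_measure_itv/= lte_fin ab -EFinB => /eqP.
  by rewrite eqe subr_eq0 gt_eqF.
move: (xab); rewrite in_itv/= => /andP[ax xb]; exists x; split => //.
(* [discontinuity] asks for unequal one-sided limits; left continuity, valid as x > 0, must still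
   identify the common limit with the value. *)
have x0 : 0 < x by exact: le_lt_trans ax.
have fl : f @ x^'- --> f x := ddf_left_cvg (ddfP F) x0.
have fr : cvg (f @ x^'+).
  apply: nondecreasing_at_right_is_cvgr.
    by near=> y => u v _ _; exact: fnd.
  by near=> y; exists 0 => _ [u _ <-]; exact: ddf_ge0.
apply/left_right_continuousP; split; first exact: fl.
suff -> : F x%:E = lim (f @ x^'+) by exact: fr.
apply/eqP; rewrite -[X in X == _](cvg_lim _ fl)//.
apply/negPn/negP => ne; apply: xd; split => //.
by apply/cvg_ex; exists (f x).
Unshelve. all: by end_near. Qed.

(** Convergence is known only at continuity points of F; one is taken between s and t. *)
Lemma ddf_weak_cvg_gt (F_ : nat -> ddf R) F (c s t : R) :
  ddf_weak_cvg F_ F -> s < t -> c < F s%:E ->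
  \forall n \near \oo, c < F_ n t%:E.
Proof.
move=> FF st cs; have [s0|s0] := leP s 0.
  near=> n; apply: lt_le_trans (ddf_ge0 _ _).
  by rewrite -(@ddf_npos F s%:E).
have [x [sx xt cx]] := ddf_continuity_point F (ltW s0) st.
have cFx : c < F x%:E by rewrite (lt_le_trans cs)// ddf_mono// lee_fin ltW.
have cFn : \forall n \near \oo, c < F_ n x%:E.
  by apply: cvgr_gt cFx; exact: FF (lt_trans s0 sx) cx.
apply: filterS cFn => n cFn; apply: lt_le_trans cFn _; apply: ddf_mono.
by rewrite lee_fin ltW.
Unshelve. all: by end_near. Qed.

Lemma ddf_weak_cvg_lt (F_ : nat -> ddf R) F (c s t : R) :
  ddf_weak_cvg F_ F -> 0 < c -> s < t -> F t%:E < c ->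
  \forall n \near \oo, F_ n s%:E < c.
Proof.
move=> FF c0 st tc; have [s0|s0] := leP s 0.
  by near=> n; rewrite ddf_npos.
have [x [sx xt cx]] := ddf_continuity_point F (ltW s0) st.
have cFx : F x%:E < c by rewrite (le_lt_trans _ tc)// ddf_mono// lee_fin ltW.
have cFn : \forall n \near \oo, F_ n x%:E < c.
  by apply: cvgr_lt cFx; exact: FF (lt_trans s0 sx) cx.
apply: filterS cFn => n; apply: le_lt_trans; apply: ddf_mono.
by rewrite lee_fin ltW.
Unshelve. all: by end_near. Qed.

(** The loss from x to y in the upper estimate is absorbed by continuity of F at x. *)
Lemma ddf_weak_cvg_intro (F_ : nat -> ddf R) F :
  (forall c x : R, 0 <= c -> c < F x%:E -> \forall n \near \oo, c < F_ n x%:E) ->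
  (forall c x y : R, 0 < x -> x < y -> F y%:E < c ->
    \forall n \near \oo, F_ n x%:E < c) ->
  ddf_weak_cvg F_ F.
Proof.
move=> Fgt Flt x x0 Fx; apply/cvgrPdist_lt => e e0.
have [y xy Fy] : exists2 y, x < y & F y%:E < F x%:E + e.
  have : \forall y \near x^'+, F y%:E < F x%:E + e.
    by apply: cvg_within; apply: (cvgr_lt (F x%:E) Fx); rewrite ltrDl.
  move=> Fy; near x^'+ => y; exists y; last by near: y.
  by near: y; exact: nbhs_right_gt.
have Fgtx : \forall n \near \oo, F x%:E - e < F_ n x%:E.
  have [F0|F0] := ltP (F x%:E - e) 0.
    by near=> n; apply: lt_le_trans F0 (ddf_ge0 _ _).
  by apply: Fgt => //; rewrite ltrBlDr ltrDl.
near=> n; rewrite ltr_distlC; apply/andP; split; near: n => //.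
exact: Flt x0 xy Fy.
Unshelve. all: by end_near. Qed.

End weak_convergence.

(** * [tauM] and [tauMstar] as triangle functions *)

Section triangle_functions.
Context {R : realType}.
Implicit Types (F H K : ddf R).

Lemma ddf_le_anti F H : ddf_le F H -> ddf_le H F -> F = H.
Proof. by move=> FH HF; apply: ddf_ext => x; apply/eqP; rewrite eq_le FH HF. Qed.

Lemma splitsC (x : \bar R) s t : splits x (s, t) -> splits x (t, s).
Proof. by move=> [/= s0 t0 <-]; split=> //=; rewrite addeC. Qed.

Lemma splitsA (x : \bar R) s t u v : splits x (s, t) -> splits t (u, v) ->
  splits (s + u)%E (s, u) /\ splits x ((s + u)%E, v).
Proof.
move=> [/= s0 t0 <-] [/= u0 v0 <-].
by split; split=> //=; rewrite ?adde_ge0// addeA.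
Qed.

(** Otherwise u < s and v < t would add up to x < x. This links minima over one split to maxima over
    another. *)
Lemma splits_ltNge (x : \bar R) s t u v : splits x (s, t) -> splits x (u, v) ->
  (s <= u)%E \/ (t <= v)%E.
Proof.
move=> [/= _ _ stx] [/= _ _ uvx].
have [|us] := leP s u; first by left.
have [|vt] := leP t v; first by right.
by have := lteD us vt; rewrite stx uvx ltxx.
Qed.

Lemma tauM_leP F H K : ddf_le (tauM F H) K <->
  forall (x : \bar R) st, splits x st -> Num.min (F st.1) (H st.2) <= K x.
Proof.
split=> [FHK x st xst|FHK x]; first exact: le_trans (tauM_ge F H xst) (FHK x).
by apply: tauM_le => [|st xst]; [exact: ddf_ge0|exact: FHK].
Qed.

Lemma tauMstar_geP F H K : ddf_le K (tauMstar F H) <->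
  forall (x : \bar R) st, splits x st -> K x <= Num.max (F st.1) (H st.2).
Proof.
split=> [FHK x st xst|FHK x].
  exact: le_trans (FHK x) (tauMstar_le F H xst).
have [x0|x0] := leP x 0%E; first by rewrite ddf_npos// ddf_ge0.
by apply: tauMstar_ge => [|st xst]; [exact: ltW|exact: FHK].
Qed.

Lemma tauMC F H : tauM F H = tauM H F.
Proof.
wlog suff : F H / ddf_le (tauM F H) (tauM H F).
  by move=> FH; apply: ddf_le_anti; exact: FH.
apply/tauM_leP => x [s t] /splitsC xts; rewrite minC.
exact: tauM_ge H F _ _ xts.
Qed.

Lemma tauMstarC F H : tauMstar F H = tauMstar H F.
Proof.
wlog suff : F H / ddf_le (tauMstar H F) (tauMstar F H).
  by move=> FH; apply: ddf_le_anti; exact: FH.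
apply/tauMstar_geP => x [s t] /splitsC xts; rewrite maxC.
exact: tauMstar_le H F _ _ xts.
Qed.

(** Commutativity turns one inequality into its converse. As suprema need not be attained, that
    inequality is proved by contradiction, with the right-hand value as a strict level. *)
Lemma tauMA F H K : tauM F (tauM H K) = tauM (tauM F H) K.
Proof.
have le1 F1 F2 F3 : ddf_le (tauM F1 (tauM F2 F3)) (tauM (tauM F1 F2) F3).
  apply/tauM_leP => x [s t] xst /=; rewrite leNgt; apply/negP.
  rewrite lt_min => /andP[c1 c2].
  have [[u v] tuv] := tauM_ex (ddf_ge0 (tauM (tauM F1 F2) F3) x) c2.
  rewrite lt_min => /andP[cu cv]; have [sus xsuv] := splitsA xst tuv.
  have := tauM_ge (tauM F1 F2) F3 xsuv; apply/negP; rewrite -ltNge /= lt_min cv.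
  rewrite andbT; apply: lt_le_trans (tauM_ge F1 F2 sus).
  by rewrite /= lt_min c1.
apply: ddf_le_anti; first exact: le1.
by rewrite (tauMC (tauM F H)) (tauMC F (tauM H K)) (tauMC F H) (tauMC H K).
Qed.

Lemma tauMstarA F H K : tauMstar F (tauMstar H K) = tauMstar (tauMstar F H) K.
Proof.
have le1 F1 F2 F3 :
    ddf_le (tauMstar (tauMstar F1 F2) F3) (tauMstar F1 (tauMstar F2 F3)).
  apply/tauMstar_geP => x [s t] xst /=; rewrite leNgt; apply/negP.
  rewrite gt_max => /andP[c1 c2].
  have [[u v] tuv] : exists2 st, splits t st &
      Num.max (F2 st.1) (F3 st.2) < tauMstar (tauMstar F1 F2) F3 x.
    by apply: tauMstar_ex c2; case: xst.
  rewrite gt_max => /andP[cu cv]; have [sus xsuv] := splitsA xst tuv.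
  have := tauMstar_le (tauMstar F1 F2) F3 xsuv; apply/negP.
  rewrite -ltNge /= gt_max cv andbT.
  apply: le_lt_trans (tauMstar_le F1 F2 sus) _.
  by rewrite /= gt_max c1.
apply: ddf_le_anti; last exact: le1.
by rewrite (tauMstarC (tauMstar F H)) (tauMstarC F (tauMstar H K))
  (tauMstarC F H) (tauMstarC H K).
Qed.

Lemma tauM_mono F F' H H' :
  ddf_le F F' -> ddf_le H H' -> ddf_le (tauM F H) (tauM F' H').
Proof.
move=> FF HH; apply/tauM_leP => x st xst; apply: le_trans (tauM_ge F' H' xst).
exact: le_min2.
Qed.

Lemma tauMstar_mono F F' H H' :
  ddf_le F F' -> ddf_le H H' -> ddf_le (tauMstar F H) (tauMstar F' H').
Proof.
move=> FF HH; apply/tauMstar_geP => x st xst.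
apply: le_trans (tauMstar_le F H xst) _.
exact: le_max2.
Qed.

Lemma tauM_le_tauMstar F H : ddf_le (tauM F H) (tauMstar F H).
Proof.
apply/tauM_leP => x st xst; apply: tauMstar_ge; first exact: splits_ge0 xst.
move: st xst => [s t] xst [u v] xuv /=; rewrite ge_min !le_max.
by have [/ddf_mono->|/ddf_mono->] := splits_ltNge xst xuv; rewrite ?orbT.
Qed.

Lemma eps0_gt0 (x : \bar R) : (0 < x)%E -> eps0 R x = 1.
Proof. by move=> x0; rewrite /ddf_fun/= /eps0_fun x0. Qed.

Lemma tauM_eps0 F : tauM (eps0 R) F = F.
Proof.
apply: ddf_le_anti.
  apply/tauM_leP => x [s t] [/= s0 t0 stx]; rewrite ge_min ddf_mono ?orbT//.
  by rewrite -stx leeDr.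
move=> [x| |]; last by rewrite ddf_npos ?ddf_ge0// leNye.
  have [x0|x0] := leP x 0; first by rewrite ddf_npos ?ddf_ge0.
  rewrite leNgt; apply/negP => cx.
  (* The split (0, x) only yields 0, since [eps0] vanishes at 0; the supremum is approached by
     splits (x - y, y) with y < x. *)
  have [y [y0 yx cy]] := left_cvg_elim x0 (ddf_left_cvg (ddfP F) x0) cx.
  have xy : splits x%:E ((x - y)%:E, y%:E).
    split=> //=; rewrite ?lee_fin ?subr_ge0 ?(ltW yx) ?(ltW y0)//.
    by rewrite -EFinD subrK.
  suff : F y%:E <= tauM (eps0 R) F x%:E by rewrite leNgt cy.
  apply: le_trans (tauM_ge (eps0 R) F xy).
  by rewrite /= eps0_gt0 ?lte_fin ?subr_gt0// le_min ddf_le1 lexx.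
by rewrite (ddf_pinfty (ddfP (tauM _ _))) ddf_le1.
Qed.

Lemma tauMstar_eps0 F : tauMstar (eps0 R) F = F.
Proof.
apply: ddf_le_anti => [x|].
  have [x0|x0] := leP x 0%E; first by rewrite ddf_npos// ddf_ge0.
  apply: le_trans (tauMstar_le (eps0 R) F (splits0l (ltW x0))) _.
  by rewrite /= ddf_npos// ge_max ddf_ge0 lexx.
apply/tauMstar_geP => x [s t] [/= s0 t0 <-]; rewrite le_max.
move: s0; rewrite le_eqVlt => /predU1P[<-|s0]; first by rewrite add0e lexx orbT.
by rewrite eps0_gt0// ddf_le1.
Qed.

Lemma tauM_triangle : triangle_function (@tauM R).
Proof.
split; [exact: tauMC|exact: tauMA|exact: tauM_mono|exact: tauM_eps0].
Qed.

Lemma tauMstar_triangle : triangle_function (@tauMstar R).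
Proof.
split; [exact: tauMstarC|exact: tauMstarA|exact: tauMstar_mono|].
exact: tauMstar_eps0.
Qed.

(** * Weak continuity of [tauM] and [tauMstar] *)

Lemma splits_EFin (s t : R) : 0 <= s -> 0 <= t ->
  splits (s + t)%:E (s%:E, t%:E).
Proof. by split; rewrite ?lee_fin. Qed.

(* Negative summands cost nothing: a distribution function vanishes there. *)
Lemma tauM_geD F H (s t : R) :
  Num.min (F s%:E) (H t%:E) <= tauM F H (s + t)%:E.
Proof.
have [s0|s0] := ltP s 0.
  by rewrite ge_min ddf_npos ?ddf_ge0// lee_fin ltW.
have [t0|t0] := ltP t 0.
  by rewrite ge_min (ddf_npos H) ?ddf_ge0 ?orbT// lee_fin ltW.
exact: tauM_ge (splits_EFin s0 t0).
Qed.

(** If s < 0 < s + t, the split (0, s + t) serves, since F is 0 at 0 and H (s + t) <= H t; likewise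
    for t < 0. *)
Lemma tauMstar_leD F H (s t : R) :
  tauMstar F H (s + t)%:E <= Num.max (F s%:E) (H t%:E).
Proof.
have [st0|st0] := leP (s + t) 0.
  by rewrite ddf_npos ?lee_fin// le_max ddf_ge0.
have [s0|s0] := ltP s 0.
  rewrite -[s + t]add0r.
  apply: le_trans (tauMstar_le F H (splits_EFin _ (ltW st0))) _ => //=.
  apply: le_max2; first by rewrite ddf_npos ?ddf_ge0.
  by rewrite ddf_mono// lee_fin gerDr ltW.
have [t0|t0] := ltP t 0.
  rewrite -[s + t]addr0.
  apply: le_trans (tauMstar_le F H (splits_EFin (ltW st0) _)) _ => //=.
  apply: le_max2; last by rewrite ddf_npos ?ddf_ge0.
  by rewrite ddf_mono// lee_fin gerDl ltW.
exact: tauMstar_le (splits_EFin s0 t0).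
Qed.

Lemma tauM_weakly_continuous : weakly_continuous (@tauM R).
Proof.
move=> F_ H_ F H FF HH; apply: ddf_weak_cvg_intro => [c x c0 cx|c x y x0 xy yc].
  have [[_ _] /splits_fin[s [t [-> -> s0 t0 stx]]] /=] := tauM_ex c0 cx.
  rewrite lt_min => /andP[cs ct].
  have gt0 K (r : R) : 0 <= r -> c < K r%:E -> 0 < r.
    move=> r0 cr; rewrite lt_neqAle r0 andbT eq_sym; apply: contraTneq cr => ->.
    by rewrite ddf_npos// -leNgt.
  have s_gt0 := gt0 F s s0 cs; have t_gt0 := gt0 H t t0 ct.
  (* Left continuity opens the gaps s' < s and t' < t that weak convergence needs. *)
  have [s' [_ ss' cs']] := left_cvg_elim s_gt0 (ddf_left_cvg (ddfP F) s_gt0) cs.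
  have [t' [_ tt' ct']] := left_cvg_elim t_gt0 (ddf_left_cvg (ddfP H) t_gt0) ct.
  near=> n; rewrite -stx; apply: lt_le_trans (tauM_geD _ _ _ _).
  rewrite lt_min; apply/andP; split; near: n.
    exact: ddf_weak_cvg_gt FF ss' cs'.
  exact: ddf_weak_cvg_gt HH tt' ct'.
have y0 : 0 <= y by rewrite ltW// (lt_trans x0).
have c0 : 0 < c := le_lt_trans (ddf_ge0 _ _) yc.
have [d yd dc] : exists2 d, tauM F H y%:E < d & d < c.
  by exists ((tauM F H y%:E + c) / 2); rewrite midf_lt.
have d0 : 0 <= d := ltW (le_lt_trans (ddf_ge0 _ _) yd).
have [s [s0 sy Fs sP]] := ddf_sublevel F y0 d0.
have [t [t0 ty Ht tP]] := ddf_sublevel H y0 d0.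
(* s and t are the last points of [0, y] where F and H are at most d. If s + t < y, moving both
   right by half the gap would split y with both values above d. *)
have yst : y <= s + t.
  rewrite leNgt; apply/negP => sty; pose e := (y - s - t) / 2.
  have Fse : d < F (s + e)%:E.
    rewrite ltNge; apply/negP => /(sP _); rewrite /e => ?; lra.
  have Hte : d < H (t + e)%:E.
    rewrite ltNge; apply/negP => /(tP _); rewrite /e => ?; lra.
  have := tauM_geD F H (s + e) (t + e).
  rewrite (_ : s + e + (t + e) = y); last by rewrite /e; lra.
  by apply/negP; rewrite -ltNge (lt_trans yd)// lt_min Fse.
(* Now (s - e) + (t - e) >= x, so every split (u, v) of x has u <= s - e or v <= t - e: two points
   control the whole supremum. *)
pose e := (y - x) / 2.
have [es et] : s - e < s /\ t - e < t by split; rewrite /e; lra.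
near=> n.
have Fn : F_ n (s - e)%:E < c.
  by near: n; apply: ddf_weak_cvg_lt FF c0 es (le_lt_trans Fs dc).
have Hn : H_ n (t - e)%:E < c.
  by near: n; apply: ddf_weak_cvg_lt HH c0 et (le_lt_trans Ht dc).
apply: le_lt_trans (_ : _ <= Num.max (F_ n (s - e)%:E) (H_ n (t - e)%:E)) _.
  apply: tauM_le => [|[_ _] /splits_fin[u [v [-> -> u0 v0 uvx]]]].
    by rewrite le_max ddf_ge0.
  have [us|su] := leP u (s - e).
    by rewrite /= ge_min le_max ddf_mono// lee_fin.
  rewrite /= ge_min !le_max (@ddf_mono _ (H_ n) v%:E) ?orbT// lee_fin.
  by move: su; rewrite /e; lra.
by rewrite gt_max Fn.
Unshelve. all: by end_near. Qed.

Lemma tauMstar_weakly_continuous : weakly_continuous (@tauMstar R).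
Proof.
move=> F_ H_ F H FF HH; apply: ddf_weak_cvg_intro => [c x c0 cx|c x y x0 xy yc].
  have x0 : 0 < x.
    rewrite ltNge; apply/negP => x0.
    by move: cx; rewrite ddf_npos ?lee_fin// ltNge c0.
  (* Left continuity of [tauMstar F H] gives the room between y and x. *)
  have [y [y_gt0 yx cy]] :=
    left_cvg_elim x0 (ddf_left_cvg (ddfP (tauMstar F H)) x0) cx.
  have y0 := ltW y_gt0.
  have [s [s0 sy Fs sP]] := ddf_sublevel F y0 c0.
  have [t [t0 ty Ht tP]] := ddf_sublevel H y0 c0.
  have sty : s + t < y.
    rewrite ltNge; apply/negP => yst.
    have := tauMstar_leD F H s (y - s).
    rewrite addrC subrK; apply/negP; rewrite -ltNge; apply: le_lt_trans cy.
    rewrite ge_max Fs (le_trans _ Ht)// ddf_mono// lee_fin; lra.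
  (* F and H exceed c at s + e and t + e, past their last points of level c. The points s + e' and t
     + e' lie further right and add up to x, so every split of x reaches one of them. *)
  pose e := (y - s - t) / 2; pose e' := (x - s - t) / 2.
  have Fse : c < F (s + e)%:E.
    rewrite ltNge; apply/negP => /(sP _); rewrite /e => ?; lra.
  have Hte : c < H (t + e)%:E.
    rewrite ltNge; apply/negP => /(tP _); rewrite /e => ?; lra.
  have [es et] : s + e < s + e' /\ t + e < t + e'.
    by split; rewrite /e /e'; lra.
  near=> n.
  have Fn : c < F_ n (s + e')%:E.
    by near: n; apply: ddf_weak_cvg_gt FF es Fse.
  have Hn : c < H_ n (t + e')%:E.
    by near: n; apply: ddf_weak_cvg_gt HH et Hte.
  apply: lt_le_trans
    (_ : Num.min (F_ n (s + e')%:E) (H_ n (t + e')%:E) <= _).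
    by rewrite lt_min Fn.
  apply: tauMstar_ge => [|[_ _] /splits_fin[u [v [-> -> u0 v0 uvx]]]].
    by rewrite lee_fin ltW.
  have [su|us] := leP (s + e') u.
    by rewrite /= ge_min le_max ddf_mono// lee_fin.
  rewrite /= ge_min !le_max (@ddf_mono _ (H_ n) _ v%:E) ?orbT// lee_fin.
  by move: us; rewrite /e'; lra.
have y0 : (0 <= y%:E)%E by rewrite lee_fin ltW// (lt_trans x0).
have c0 : 0 < c := le_lt_trans (ddf_ge0 _ _) yc.
have [[_ _] /splits_fin[s [t [-> -> s0 t0 sty]]] /=] := tauMstar_ex y0 yc.
rewrite gt_max => /andP[sc tc]; pose e := (y - x) / 2.
have [es et] : s - e < s /\ t - e < t by split; rewrite /e; lra.
(* Moving both parts of the split of y left by e gives parts with sum x, possibly negative, which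
   [tauMstar_leD] allows. *)
near=> n; rewrite (_ : x = (s - e) + (t - e)); last by rewrite /e; lra.
apply: le_lt_trans (tauMstar_leD _ _ _ _) _.
rewrite gt_max; apply/andP; split; near: n.
  exact: ddf_weak_cvg_lt FF c0 es sc.
exact: ddf_weak_cvg_lt HH c0 et tc.
Unshelve. all: by end_near. Qed.

End triangle_functions.

(** * Simple spaces and their dependence on the norm *)

Section simple_spaces.
Context {R : realType} (G : ddf R).
Implicit Types V : normedModType R.

Lemma simple_nu0 V : simple_nu G (0 : V) = eps0 R.
Proof. by apply: ddf_ext => x; rewrite {1}/ddf_fun/= /simple_nu_fun eqxx. Qed.

Lemma simple_nuE V (p : V) x : p != 0 ->
  simple_nu G p x = G (x * (`|p|^-1)%:E)%E.
Proof. by move=> p0; rewrite {1}/ddf_fun/= /simple_nu_fun (negbTE p0). Qed.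

(** For x > 0, x / |q| <= x / |p|, and G is monotone. The two spaces may differ, so that only norms
    are compared. *)
Lemma simple_nu_anti V1 V2 (p : V1) (q : V2) :
  `|p| <= `|q| -> ddf_le (simple_nu G q) (simple_nu G p).
Proof.
move=> pq x; have [x0|x0] := leP x 0%E; first by rewrite ddf_npos// ddf_ge0.
have [->|p0] := eqVneq p 0; first by rewrite simple_nu0 eps0_gt0// ddf_le1.
have np0 : 0 < `|p| by rewrite normr_gt0.
have nq0 := lt_le_trans np0 pq.
rewrite !simple_nuE//; last by rewrite -normr_gt0.
by apply: ddf_mono; apply: lee_wpmul2l; rewrite ?lee_fin ?lef_pV2// ltW.
Qed.

Lemma simple_nu_norm V1 V2 (p : V1) (q : V2) :
  `|p| = `|q| -> simple_nu G p = simple_nu G q.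
Proof. by move=> pq; apply: ddf_le_anti; apply: simple_nu_anti; rewrite pq. Qed.

(* The witness splits x in the ratio |p| : |q|. *)
Lemma simple_nu_split V1 V2 V3 (p : V1) (q : V2) (r : V3) x :
  p != 0 -> q != 0 -> `|r| = `|p| + `|q| -> (0 <= x)%E ->
  exists st, [/\ splits x st, simple_nu G p st.1 = simple_nu G r x &
    simple_nu G q st.2 = simple_nu G r x].
Proof.
move=> p0 q0 rpq x0.
have np0 : 0 < `|p| by rewrite normr_gt0.
have nq0 : 0 < `|q| by rewrite normr_gt0.
have nr0 : 0 < `|r| by rewrite rpq addr_gt0.
exists ((x * (`|p| / `|r|)%:E)%E, (x * (`|q| / `|r|)%:E)%E).
split; rewrite /= ?simple_nuE// -?normr_gt0// -?muleA -?EFinM.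
- split=> /=; rewrite ?mule_ge0 ?lee_fin ?divr_ge0//.
  rewrite -ge0_muleDr ?lee_fin ?divr_ge0// -EFinD -mulrDl -rpq divff ?gt_eqF//.
  by rewrite mule1.
- by rewrite mulrAC divff ?gt_eqF// mul1r.
- by rewrite mulrAC divff ?gt_eqF// mul1r.
Qed.

(** For a zero vector the identity law of [eps0] replaces the ratio split. r has its own space: the
    sum-normed product for the main formula, the real line for (N3). *)
Lemma tauM_simple_nu V1 V2 V3 (p : V1) (q : V2) (r : V3) :
  `|r| = `|p| + `|q| -> tauM (simple_nu G p) (simple_nu G q) = simple_nu G r.
Proof.
have [->|p0] := eqVneq p 0.
  by rewrite normr0 add0r simple_nu0 tauM_eps0 => /simple_nu_norm.
have [->|q0] := eqVneq q 0.
  by rewrite normr0 addr0 simple_nu0 tauMC tauM_eps0 => /simple_nu_norm.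
move=> rpq; apply: ddf_le_anti => [|x].
  apply/tauM_leP => x [s t] xst.
  have [[u v] [xuv /= pu qv]] := simple_nu_split p0 q0 rpq (splits_ge0 xst).
  rewrite ge_min; have [su|tv] := splits_ltNge xst xuv.
    by rewrite -pu ddf_mono.
  by rewrite -qv orbC ddf_mono.
have [x0|x0] := leP x 0%E; first by rewrite ddf_npos// ddf_ge0.
have [st [xst ps qt]] := simple_nu_split p0 q0 rpq (ltW x0).
by apply: le_trans (tauM_ge _ _ xst); rewrite ps qt minxx.
Qed.

Lemma tauMstar_simple_nu V1 V2 V3 (p : V1) (q : V2) (r : V3) :
  `|r| = `|p| + `|q| -> tauMstar (simple_nu G p) (simple_nu G q) = simple_nu G r.
Proof.
have [->|p0] := eqVneq p 0.
  by rewrite normr0 add0r simple_nu0 tauMstar_eps0 => /simple_nu_norm.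
have [->|q0] := eqVneq q 0.
  by rewrite normr0 addr0 simple_nu0 tauMstarC tauMstar_eps0 => /simple_nu_norm.
move=> rpq; apply: ddf_le_anti => [x|].
  have [x0|x0] := leP x 0%E; first by rewrite ddf_npos// ddf_ge0.
  have [st [xst ps qt]] := simple_nu_split p0 q0 rpq (ltW x0).
  by apply: le_trans (tauMstar_le _ _ xst) _; rewrite ps qt maxxx.
apply/tauMstar_geP => x [s t] xst.
have [[u v] [xuv /= pu qv]] := simple_nu_split p0 q0 rpq (splits_ge0 xst).
rewrite le_max; have [us|vt] := splits_ltNge xuv xst.
  by rewrite -pu ddf_mono.
by rewrite -qv orbC ddf_mono.
Qed.

Lemma simple_pn_is_pn_space V : G <> eps0 R -> is_pn_space (simple_pn V G).
Proof.
move=> G0; split => /=.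
- exact: tauM_triangle.
- exact: tauMstar_triangle.
- exact: tauM_weakly_continuous.
- exact: tauMstar_weakly_continuous.
- exact: tauM_le_tauMstar.
- move=> p; split=> [pE|->]; last exact: simple_nu0.
  apply/eqP/negP => /negP p0; apply: G0; apply: ddf_ext => x.
  have np0 : 0 < `|p| by rewrite normr_gt0.
  (* Evaluating nu_p = [eps0] at x |p| gives G x = [eps0] (x |p|) = [eps0] x. *)
  have := simple_nuE (x * `|p|%:E)%E p0.
  rewrite -muleA -EFinM divff ?gt_eqF// mule1 pE => <-.
  by rewrite /ddf_fun/= /eps0_fun pmule_lgt0 ?lte_fin.
- by move=> p; apply: simple_nu_norm; rewrite normrN.
(* The number |p| + |q| is itself a vector of the required norm, which p + q need not have. *)
- move=> p q; pose r : R^o := `|p| + `|q|.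
  have rE : `|r| = `|p| + `|q| by rewrite ger0_norm// addr_ge0.
  rewrite (tauM_simple_nu rE); apply: simple_nu_anti.
  by rewrite rE ler_normD.
- move=> p a /andP[a0 a1].
  rewrite (@tauMstar_simple_nu _ _ V _ _ p) => [x//|].
  by rewrite !normrZ -mulrDl !ger0_norm ?subr_ge0// addrC subrK mul1r.
Qed.

End simple_spaces.

Theorem theorem5 (R : realType) (V1 V2 : normedModType R) (G : ddf R)
    (hG0 : G <> eps0 R) (hGoo : G <> epsoo R) :
  is_pn_space (simple_pn V1 G) /\
  is_pn_space (simple_pn V2 G) /\
  is_pn_space (simple_pn (sum_normed V1 V2) G) /\
  tauM_product (S1 := simple_pn V1 G) (S2 := simple_pn V2 G) erefl erefl =
    simple_pn (sum_normed V1 V2) G.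
Proof.
do 3?[split; first exact: simple_pn_is_pn_space].
(* The linear structure of [sum_normed] is copied from the product, so the quadruples differ only in
   nu. *)
apply: (f_equal (fun nu =>
  @PNQuadruple R (V1 * V2)%type nu (@tauM R) (@tauMstar R))).
by apply/funext => p; exact: tauM_simple_nu.
Qed.
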